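(* Let $X$ be a non-empty set and let $(F,r_F)$, with map $i\colon X\to F$, be the free solution on $X$ (the free object on $X$ in the category of solutions). Let $G(F,r_F)$ be its structure skew brace and $g_F\colon F\to G(F,r_F)$ the canonical map. Then $G(F,r_F)$, together with the map $g_F\circ i\colon X\to G(F,r_F)$, is the free skew brace on $X$; that is, for every skew brace $B$ and every map $f\colon X\to B$ there is a unique skew brace homomorphism $\varphi\colon G(F,r_F)\to B$ with $\varphi\circ g_F\circ i=f$.
   Context: A (left) skew brace is a triple $(B,+,\circ)$ with $(B,+)$ and $(B,\circ)$ groups (not necessarily abelian) such that $a\circ(b+c)=a\circ b-a+a\circ c$ for all $a,b,c\in B$. Homomorphisms are maps preserving both operations. The $\lambda$-action is $\lambda_a(b)=-a+a\circ b$, and $\bar a$ denotes the inverse of $a$ in $(B,\circ)$. A solution is a pair $(X,r)$ with $X$ a non-empty set and $r\colon X^2\to X^2$ a bijection with $(r\times\mathrm{id})(\mathrm{id}\times r)(r\times\mathrm{id})=(\mathrm{id}\times r)(r\times\mathrm{id})(\mathrm{id}\times r)$ on $X^3$, such that, writing $r(x,y)=(\lambda_x(y),\rho_y(x))$, all maps $\lambda_x,\rho_x\colon X\to X$ are bijective. A morphism of solutions $f\colon(X,r)\to(Y,s)$ is a map $f\colon X\to Y$ with $(f\times f)r=s(f\times f)$. Each skew brace $B$ yields a solution $(B,r_B)$, $r_B(a,b)=(\lambda_a(b),\overline{\lambda_a(b)}\circ a\circ b)$. For a solution $(X,r)$, the structure group is $(G(X,r),\circ)=\langle X\mid x\circ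 y=u\circ v \text{ whenever } r(x,y)=(u,v)\rangle$; it carries a second group operation $+$, determined on generators by $x+y=x\circ\lambda_x^{-1}(y)$, making $(G(X,r),+,\circ)$ a skew brace, the structure skew brace. The canonical map $g_X\colon X\to G(X,r)$, $x\mapsto x$, is a morphism of solutions $(X,r)\to(G(X,r),r_{G(X,r)})$, and is universal among morphisms of solutions from $(X,r)$ to solutions $(B,r_B)$ of skew braces $B$ (it need not be injective). A free object on a set $X$ in a category of structured sets is an object $F$ with a map $i\colon X\to F$ such that each map from $X$ to an object $K$ factors as $\varphi\circ i$ for a unique morphism $\varphi\colon F\to K$. Free solutions on non-empty sets exist. *)

(* Defs.v *)
From HB Require Import structures.
From mathcomp Require Import all_boot.

Set Implicit Arguments.
Unset Strict Implicit.
Unset Printing Implicit Defensive.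

Local Open Scope ring_scope.
Local Open Scope group_scope.

(* The group (B, +) of a skew brace is written with the notations of
   [ring_scope]; the group (B, \circ) with those of [group_scope], so that
   [a * b] stands for a \circ b and [a^-1] for the inverse of a in (B, \circ).
   The operations come from the law-free structures [BaseZmodule] and
   [BaseGroup]: [zmodType] would make + commutative, and [groupType] would put
   a [choiceType] structure on the carrier, which is an arbitrary type here. *)
HB.mixin Record isSkewBrace B of Algebra.BaseZmodule B & BaseGroup B := {
  brace_addA : associative (fun a b : B => a + b);
  brace_add0 : left_id (0 : B) (fun a b : B => a + b);
  brace_addN : left_inverse (0 : B) (fun a : B => - a) (fun a b : B => a + b);
  brace_mulA : associative (fun a b : B => a * b);
  brace_mul1 : left_id (1%g : B) (fun a b : B => a * b);
  brace_mulV : left_inverse (1%g : B) (fun a : B => a^-1) (fun a b : B => a * b);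
  brace_mulD : forall a b c : B, a * (b + c) = a * b - a + a * c
}.

#[short(type="skewBraceType")]
HB.structure Definition SkewBrace :=
  {B of isSkewBrace B & Algebra.BaseZmodule B & BaseGroup B}.

Definition skew_brace_morphism (B C : skewBraceType) (phi : B -> C) : Prop :=
  {morph phi : a b / a + b} /\ {morph phi : a b / a * b}.

(* r x id and id x r, on X^3 = X * X * X *)
Definition braid_l (X : Type) (r : X * X -> X * X) (t : X * X * X) : X * X * X :=
  let: (x, y, z) := t in let: (u, v) := r (x, y) in (u, v, z).

Definition braid_r (X : Type) (r : X * X -> X * X) (t : X * X * X) : X * X * X :=
  let: (x, y, z) := t in let: (u, v) := r (y, z) in (x, u, v).

Record solution := Solution {
  solution_sort :> Type;
  solution_map : solution_sort * solution_sort -> solution_sort * solution_sort;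
  solution_nonempty : inhabited solution_sort;
  solution_bij : bijective solution_map;
  solution_braid : forall t,
    braid_l solution_map (braid_r solution_map (braid_l solution_map t)) =
    braid_r solution_map (braid_l solution_map (braid_r solution_map t));
  solution_lambda_bij : forall x, bijective (fun y => (solution_map (x, y)).1);
  solution_rho_bij : forall y, bijective (fun x => (solution_map (x, y)).2)
}.

Definition solution_lambda (S : solution) (x y : S) : S :=
  (solution_map (x, y)).1.

Definition solution_morphism (S T : solution) (f : S -> T) : Prop :=
  forall p : S * S,
    solution_map (f p.1, f p.2) =
    (f (solution_map p).1, f (solution_map p).2).

Definition is_free_solution (X : Type) (F : solution) (i : X -> F) : Prop :=
  forall (K : solution) (f : X -> K),
    exists phi : F -> K,
      [/\ solution_morphism phi,
          forall x, phi (i x) = f x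
        & forall psi : F -> K, solution_morphism psi ->
            (forall x, psi (i x) = f x) -> psi =1 phi].

Definition is_free_skew_brace (X : Type) (B : skewBraceType) (j : X -> B) :
    Prop :=
  forall (K : skewBraceType) (f : X -> K),
    exists phi : B -> K,
      [/\ skew_brace_morphism phi,
          forall x, phi (j x) = f x
        & forall psi : B -> K, skew_brace_morphism psi ->
            (forall x, psi (j x) = f x) -> psi =1 phi].

(* Group words over X: the letter [(x, false)] is x and [(x, true)] is its
   formal inverse. *)
Definition word (X : Type) : Type := seq (X * bool).

(* Equality of words in the group < X | v = w whenever R v w > *)
Inductive word_eq (X : Type) (R : word X -> word X -> Prop) :
    word X -> word X -> Prop :=
| word_eq_refl w : word_eq R w w
| word_eq_sym v w : word_eq R v w -> word_eq R w v
| word_eq_trans u v w : word_eq R u v -> word_eq R v w -> word_eq R u w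
| word_eq_cancel u v x e : word_eq R (u ++ (x, e) :: (x, ~~ e) :: v) (u ++ v)
| word_eq_rel u v s t : R s t -> word_eq R (u ++ s ++ v) (u ++ t ++ v).

Definition word_eval (X : Type) (B : skewBraceType) (g : X -> B) (w : word X) :
    B :=
  foldr (fun l b => (if l.2 then (g l.1)^-1 else g l.1) * b) 1 w.

(* Evaluation of words along g identifies the quotient of the words over X by
   [word_eq R] with (B, \circ). *)
Definition is_presented_by (X : Type) (R : word X -> word X -> Prop)
    (B : skewBraceType) (g : X -> B) : Prop :=
  (forall b : B, exists w, word_eval g w = b) /\
  (forall v w, word_eval g v = word_eval g w <-> word_eq R v w).

(* x \circ y = u \circ v whenever r (x, y) = (u, v) *)
Inductive structure_rel (S : solution) : word S -> word S -> Prop :=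
| Structure_rel x y u v : solution_map (x, y) = (u, v) ->
    structure_rel [:: (x, false); (y, false)] [:: (u, false); (v, false)].

(* [G] with the canonical map [g] is the structure skew brace of [S]; below, z
   is \lambda_x^{-1}(y).  These conditions determine the addition of [G], as
   they determine the maps a |-> a + g x. *)
Definition is_structure_skew_brace (S : solution) (G : skewBraceType)
    (g : S -> G) : Prop :=
  is_presented_by (@structure_rel S) g /\
  (forall x y z : S, solution_lambda x z = y -> g x + g y = g x * g z).

Arguments is_free_solution X F i : clear implicits.
Arguments is_free_skew_brace X B j : clear implicits.
Arguments is_structure_skew_brace S G g : clear implicits.

(* Main.v *)
Require Import Defs.
From HB Require Import structures.
From mathcomp Require Import all_boot.
From Stdlib Require Import IndefiniteDescription.

(** A morphism of solutions [h : F -> K] into a skew brace respects the defining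
    relations of the structure group, so it extends to a multiplicative morphism
    [phi : G -> K].  Additivity of [phi] amounts to [phi] commuting with the
    lambda-actions, which is checked on words through the cocycle identity
    [lambda_a (b c) = lambda_a b * lambda_(rho_b a) c]; inverse letters are
    handled by the surjectivity of the maps [rho_y] of [F].  Conversely a skew
    brace morphism on [G] restricts along [g] to a morphism of solutions on [F],
    and [F] is free. *)

Set Implicit Arguments.
Unset Strict Implicit.
Unset Printing Implicit Defensive.

Local Open Scope ring_scope.
Local Open Scope group_scope.

(** * Groups from one-sided axioms, to be applied to both operations of a skew brace *)

Section LeftGroupAxioms.

Variables (T : Type) (op : T -> T -> T) (e : T) (inv : T -> T).
Hypotheses (opA : associative op) (op1 : left_id e op)
  (opV : left_inverse e inv op).

Lemma left_group_mulKV x y : op (inv x) (op x y) = y.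
Proof. by rewrite opA opV op1. Qed.

Lemma left_group_mulI x : injective (op x).
Proof. by move=> y z /(congr1 (op (inv x))); rewrite !left_group_mulKV. Qed.

Lemma left_group_id_r : right_id e op.
Proof. by move=> x; apply: (@left_group_mulI (inv x)); rewrite opA opV op1. Qed.

Lemma left_group_inv_r : right_inverse e inv op.
Proof.
move=> x; apply: (@left_group_mulI (inv x)).
by rewrite left_group_mulKV left_group_id_r.
Qed.

End LeftGroupAxioms.

(** * Arithmetic of skew braces *)

Section SkewBraceTheory.

Variable B : skewBraceType.
Implicit Types a b c d : B.

Let addA a b c : a + (b + c) = a + b + c. Proof. exact: brace_addA. Qed.
Let mulA a b c : a * (b * c) = a * b * c. Proof. exact: brace_mulA. Qed.

Lemma brace_addr0 a : a + 0 = a.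
Proof.
exact: (left_group_id_r (@brace_addA B) (@brace_add0 B) (@brace_addN B)).
Qed.

Lemma brace_addrN a : a - a = 0.
Proof.
exact: (left_group_inv_r (@brace_addA B) (@brace_add0 B) (@brace_addN B)).
Qed.

Lemma brace_addKr a b : - a + (a + b) = b.
Proof.
exact: (left_group_mulKV (@brace_addA B) (@brace_add0 B) (@brace_addN B)).
Qed.

Lemma brace_addNKr a b : a + (- a + b) = b.
Proof. by rewrite addA brace_addrN; apply: brace_add0. Qed.

Lemma brace_addrK a b : b + a - a = b.
Proof. by rewrite -addA brace_addrN brace_addr0. Qed.

Lemma brace_addrNK a b : b - a + a = b.
Proof. by rewrite -addA [- a + a]brace_addN brace_addr0. Qed.

Lemma brace_addrI a b c : a + b = a + c -> b = c.
Proof. by move=> /(congr1 (fun d => - a + d)); rewrite !brace_addKr. Qed.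

Lemma brace_mulr1 a : a * 1 = a.
Proof.
exact: (left_group_id_r (@brace_mulA B) (@brace_mul1 B) (@brace_mulV B)).
Qed.

Lemma brace_mulrV a : a * a^-1 = 1.
Proof.
exact: (left_group_inv_r (@brace_mulA B) (@brace_mul1 B) (@brace_mulV B)).
Qed.

Lemma brace_mulKr a b : a^-1 * (a * b) = b.
Proof.
exact: (left_group_mulKV (@brace_mulA B) (@brace_mul1 B) (@brace_mulV B)).
Qed.

Lemma brace_mulVKr a b : a * (a^-1 * b) = b.
Proof. by rewrite mulA brace_mulrV; apply: brace_mul1. Qed.

Lemma brace_mulrVK a b : b * a^-1 * a = b.
Proof. by rewrite -mulA [a^-1 * a]brace_mulV brace_mulr1. Qed.

Lemma brace_mulrI a b c : a * b = a * c -> b = c.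
Proof. by move=> /(congr1 (fun d => a^-1 * d)); rewrite !brace_mulKr. Qed.

Lemma brace_invK a : a^-1^-1 = a.
Proof. by rewrite -[RHS](brace_mulKr a^-1) brace_mulV brace_mulr1. Qed.

Lemma brace_invM a b : (a * b)^-1 = b^-1 * a^-1.
Proof.
apply: (@brace_mulrI (a * b)).
by rewrite brace_mulrV -mulA brace_mulVKr brace_mulrV.
Qed.

(** Distributivity of [1 * (0 + 0)] reads [0 = - 1]. *)
Lemma brace_one0 : (1 : B) = 0.
Proof.
have := brace_mulD (1 : B) 0 0.
rewrite !brace_mul1 brace_add0 brace_addr0 brace_add0 => /(congr1 (+%R 1)).
by rewrite brace_addr0 brace_addrN.
Qed.

Lemma brace_mulN a b : a * (- b) = a - a * b + a.
Proof.
have := brace_mulD a b (- b).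
rewrite brace_addrN -brace_one0 brace_mulr1 => aE.
apply: (@brace_addrI (a * b - a)); rewrite -[LHS]aE.
by rewrite !addA brace_addrNK brace_addrN brace_add0.
Qed.

(** * The solution attached to a skew brace *)

Definition brace_lambda a b : B := - a + a * b.

Definition brace_rho b a : B := (brace_lambda a b)^-1 * (a * b).

Definition brace_solution_map (p : B * B) : B * B :=
  (brace_lambda p.1 p.2, brace_rho p.2 p.1).

Lemma brace_add_lambda a b : a + brace_lambda a b = a * b.
Proof. exact: brace_addNKr. Qed.

Lemma brace_lambda_mul_rho a b : brace_lambda a b * brace_rho b a = a * b.
Proof. exact: brace_mulVKr. Qed.

Lemma brace_lambdaD a b c :
  brace_lambda a (b + c) = brace_lambda a b + brace_lambda a c.
Proof. by rewrite /brace_lambda brace_mulD !addA. Qed.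

Lemma brace_lambdaM a b c :
  brace_lambda (a * b) c = brace_lambda a (brace_lambda b c).
Proof.
apply: (@brace_addrI (a * b)); rewrite brace_add_lambda.
by rewrite -mulA -(brace_add_lambda b c) brace_mulD -addA.
Qed.

Lemma brace_lambda1 b : brace_lambda 1 b = b.
Proof.
by rewrite -[RHS](brace_addKr 1) /brace_lambda brace_mul1 brace_one0 brace_add0.
Qed.

Lemma brace_lambdar1 a : brace_lambda a 1 = 1.
Proof.
by rewrite /brace_lambda brace_mulr1 brace_one0; apply: brace_addN.
Qed.

(** Put [u = brace_lambda a b] and [v = brace_rho b a]. Since [b * c = b + brace_lambda b c] and
    [a * b = u * v], the left side is [u + brace_lambda u (brace_lambda v c)], which is
    [u * brace_lambda v c]. *)
Lemma brace_lambda_cocycle a b c :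
  brace_lambda a (b * c) = brace_lambda a b * brace_lambda (brace_rho b a) c.
Proof.
rewrite -(brace_add_lambda b c) brace_lambdaD -brace_lambdaM.
by rewrite -brace_lambda_mul_rho brace_lambdaM brace_add_lambda.
Qed.

Lemma brace_lambda_bij a : bijective (brace_lambda a).
Proof.
exists (fun c => a^-1 * (a + c)) => b.
  by rewrite brace_add_lambda brace_mulKr.
by rewrite /brace_lambda brace_mulVKr brace_addKr.
Qed.

(** Up to inversion, [brace_rho b] is a translation in each group, hence visibly invertible. *)
Lemma brace_rhoV a b : (brace_rho b a)^-1 = (a * b)^-1 - b^-1.
Proof.
rewrite /brace_rho [LHS]brace_invM brace_invK /brace_lambda brace_mulD.
rewrite brace_mulN [_^-1 * (a * b)]brace_mulV brace_one0 brace_addr0.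
by rewrite brace_addrK brace_invM brace_mulrVK.
Qed.

Lemma brace_rho_bij b : bijective (brace_rho b).
Proof.
exists (fun v => (v^-1 + b^-1)^-1 * b^-1) => [a | v].
  by rewrite brace_rhoV brace_addrNK brace_invK -mulA brace_mulrV brace_mulr1.
rewrite -[LHS]brace_invK brace_rhoV brace_mulrVK brace_invK brace_addrK.
exact: brace_invK.
Qed.

Lemma brace_solution_map_bij : bijective brace_solution_map.
Proof.
(* If [(u, v)] is the image of [(a, b)], then [a * b = u * v] and [a + u = a * b]; this determines
   [a], then [b]. *)
exists (fun p => (p.1 * p.2 - p.1, (p.1 * p.2 - p.1)^-1 * (p.1 * p.2))).
  move=> [a b] /=; rewrite brace_lambda_mul_rho.
  have ->: a * b - brace_lambda a b = a.
    by rewrite -(brace_add_lambda a b) brace_addrK.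
  by rewrite brace_mulKr.
move=> [u v]; rewrite /brace_solution_map /=; set a := u * v - u.
have lam_a : brace_lambda a (a^-1 * (u * v)) = u.
  apply: (@brace_addrI a); rewrite brace_add_lambda brace_mulVKr.
  by rewrite /a brace_addrNK.
by rewrite /brace_rho lam_a brace_mulVKr brace_mulKr.
Qed.

(** First components agree since lambda is an action of the multiplicative group, second ones by the
    cocycle identity, and third ones by cancellation, as both sides have product [a * b * c]. *)
Lemma brace_solution_map_braid t :
  braid_l brace_solution_map
    (braid_r brace_solution_map (braid_l brace_solution_map t)) =
  braid_r brace_solution_map
    (braid_l brace_solution_map (braid_r brace_solution_map t)).
Proof.
case: t => [[a b] c] /=.
set u := brace_lambda a b; set v := brace_rho b a.
set b' := brace_lambda b c; set c' := brace_rho c b.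
have uv : u * v = a * b by apply: brace_lambda_mul_rho.
have bc : b' * c' = b * c by apply: brace_lambda_mul_rho.
have fst_eq : brace_lambda u (brace_lambda v c) = brace_lambda a b'.
  by rewrite -!brace_lambdaM uv.
have snd_eq : brace_rho (brace_lambda v c) u =
    brace_lambda (brace_rho b' a) c'.
  apply: (@brace_mulrI (brace_lambda a b')).
  rewrite -{1}fst_eq brace_lambda_mul_rho -brace_lambda_cocycle bc.
  by rewrite brace_lambda_cocycle.
have trd_eq : brace_rho c v = brace_rho c' (brace_rho b' a).
  apply: (@brace_mulrI (brace_lambda (brace_rho b' a) c')).
  rewrite brace_lambda_mul_rho -snd_eq.
  apply: (@brace_mulrI (brace_lambda a b')).
  transitivity (a * b * c).
    rewrite mulA -{1}fst_eq brace_lambda_mul_rho -mulA brace_lambda_mul_rho.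
    by rewrite mulA uv.
  by rewrite [RHS]mulA brace_lambda_mul_rho -[RHS]mulA bc mulA.
by rewrite fst_eq snd_eq trd_eq.
Qed.

Definition brace_solution : solution :=
  Solution (inhabits (1 : B)) brace_solution_map_bij brace_solution_map_braid
    brace_lambda_bij brace_rho_bij.

End SkewBraceTheory.

(** * Morphisms of skew braces and evaluation of words *)

Section SkewBraceMorphism.

Variables (B C : skewBraceType) (phi : B -> C).
Hypothesis phiP : skew_brace_morphism phi.

Lemma skew_brace_morphism0 : phi 0 = 0.
Proof.
apply: (@brace_addrI _ (phi 0)).
by case: phiP => phiD _; rewrite -phiD !brace_addr0.
Qed.

Lemma skew_brace_morphism1 : phi 1 = 1.
Proof. by rewrite !brace_one0 skew_brace_morphism0. Qed.

Lemma skew_brace_morphismN a : phi (- a) = - phi a.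
Proof.
apply: (@brace_addrI _ (phi a)); case: phiP => phiD _.
by rewrite -phiD !brace_addrN skew_brace_morphism0.
Qed.

Lemma skew_brace_morphismV a : phi a^-1 = (phi a)^-1.
Proof.
apply: (@brace_mulrI _ (phi a)); case: phiP => _ phiM.
by rewrite -phiM !brace_mulrV skew_brace_morphism1.
Qed.

Lemma skew_brace_morphism_solution :
  solution_morphism (S := brace_solution B) (T := brace_solution C) phi.
Proof.
move=> [a b] /=; case: (phiP) => phiD phiM.
rewrite /brace_solution_map /= /brace_rho /brace_lambda.
by rewrite !(phiD, phiM, skew_brace_morphismV, skew_brace_morphismN).
Qed.

Lemma skew_brace_morphism_word_eval (X : Type) (g : X -> B) w :
  phi (word_eval g w) = word_eval (phi \o g) w.
Proof.
case: (phiP) => _ phiM; elim: w => [|[x []] w IHw] /=.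
- exact: skew_brace_morphism1.
- by rewrite phiM skew_brace_morphismV IHw.
- by rewrite phiM IHw.
Qed.

End SkewBraceMorphism.

Lemma word_eval_cat (X : Type) (B : skewBraceType) (g : X -> B) v w :
  word_eval g (v ++ w) = word_eval g v * word_eval g w.
Proof.
elim: v => [|l v IHv] /=; first by rewrite brace_mul1.
by rewrite IHv; apply: brace_mulA.
Qed.

Lemma eq_word_eval (X : Type) (B : skewBraceType) (g h : X -> B) :
  g =1 h -> word_eval g =1 word_eval h.
Proof. by move=> gh; elim=> [|l w IHw] //=; rewrite gh IHw. Qed.

(** Universal property of a presentation: a map that respects the relators respects every equality
    they generate. *)
Lemma word_eq_eval (X : Type) (B : skewBraceType) (g : X -> B)
    (R : word X -> word X -> Prop) :
    (forall v w, R v w -> word_eval g v = word_eval g w) ->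
  forall v w, word_eq R v w -> word_eval g v = word_eval g w.
Proof.
move=> gR v w; elim=> {v w} [//|//|u v w _ -> _ ->//|u v x e|u v s t /gR st].
  rewrite !word_eval_cat /=; congr (_ * _).
  by case: e; rewrite /= ?brace_mulKr ?brace_mulVKr.
by rewrite !word_eval_cat st.
Qed.

Lemma solution_morphism_structure_rel (S : solution) (B : skewBraceType)
    (h : S -> B) :
    solution_morphism (T := brace_solution B) h ->
  forall v w, structure_rel v w -> word_eval h v = word_eval h w.
Proof.
move=> hP _ _ [x y u v rxy] /=; have [hu hv] := hP (x, y).
move: hu hv; rewrite rxy /= => <- <-; rewrite !brace_mulr1.
by rewrite brace_lambda_mul_rho.
Qed.

(** * The structure skew brace and extension of morphisms out of it *)

Section StructureSkewBrace.

Variables (F : solution) (G : skewBraceType) (g : F -> G).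
Hypothesis gP : is_structure_skew_brace F G g.

(** The condition on addition gives the lambda component; the relation [g x * g y = g u * g v] then
    gives the rho component. *)
Lemma structure_solution_morphism :
  solution_morphism (T := brace_solution G) g.
Proof.
case: gP => [[_ gE] gD] [x y]; case rxy: (solution_map (x, y)) => [u v] /=.
have lamE : brace_lambda (g x) (g y) = g u.
  apply: (@brace_addrI _ (g x)); rewrite brace_add_lambda.
  by rewrite -(gD x u y) // /solution_lambda rxy.
have guv : g x * g y = g u * g v.
  have [_] := gE [:: (x, false); (y, false)] [:: (u, false); (v, false)].
  rewrite /= !brace_mulr1; apply.
  exact: (@word_eq_rel _ _ [::] [::] _ _ (Structure_rel rxy)).
by rewrite /brace_solution_map /= /brace_rho lamE guv brace_mulKr.
Qed.

Lemma structure_brace_lambda x y :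
  brace_lambda (g x) (g y) = g (solution_map (x, y)).1.
Proof. by have [] := structure_solution_morphism (x, y). Qed.

Lemma structure_brace_rho x y :
  brace_rho (g y) (g x) = g (solution_map (x, y)).2.
Proof. by have [] := structure_solution_morphism (x, y). Qed.

Section Extension.

Variables (K : skewBraceType) (h : F -> K).
Hypothesis hP : solution_morphism (T := brace_solution K) h.

Lemma structure_lift_mul : exists phi : G -> K,
  (forall x, phi (g x) = h x) /\ {morph phi : a b / a * b}.
Proof.
case: gP => [[g_surj gE] _].
(* [wd] picks a word for each element of [G]. Evaluation along [h] does not depend on the word,
   since words with equal value in [G] are [word_eq]. *)
have [wd wdE] := functional_choice (fun b w => word_eval g w = b) g_surj.
have phiE w : word_eval h (wd (word_eval g w)) = word_eval h w.
  apply: (word_eq_eval (solution_morphism_structure_rel hP)).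
  by apply/gE; rewrite wdE.
exists (word_eval h \o wd); split=> [x | a b] /=.
  by have := phiE [:: (x, false)]; rewrite /= !brace_mulr1.
by rewrite -word_eval_cat -{1}(wdE a) -{1}(wdE b) -word_eval_cat phiE.
Qed.

Variable phi : G -> K.
Hypotheses (phi_g : forall x, phi (g x) = h x)
  (phiM : {morph phi : a b / a * b}).

Let phi1 : phi 1 = 1.
Proof.
apply: (@brace_mulrI _ (phi 1)); rewrite -phiM.
by rewrite !brace_mulr1.
Qed.

Let phiV a : phi a^-1 = (phi a)^-1.
Proof.
by apply: (@brace_mulrI _ (phi a)); rewrite -phiM !brace_mulrV phi1.
Qed.

Lemma structure_lift_lambda_gen x c :
  phi (brace_lambda (g x) c) = brace_lambda (h x) (phi c).
Proof.
have h_lam y z : brace_lambda (h y) (h z) = h (solution_map (y, z)).1.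
  by have [] := hP (y, z).
have h_rho y z : brace_rho (h z) (h y) = h (solution_map (y, z)).2.
  by have [] := hP (y, z).
case: gP => [[g_surj _] _]; have [w <-] := g_surj c.
(* [x] stays general: moving past a letter [y] replaces it by its image or a preimage under the rho
   map of [y]. *)
elim: w x => [|[y []] w IHw] x /=.
- by rewrite phi1 !brace_lambdar1.
- (* With [rho_y x' = x], the cocycle identity at [x'] expresses
     [lambda_x (y^-1 d)] as [(lambda_x' y)^-1 * lambda_x' d]. *)
  have [rho' _ rhoK] := solution_rho_bij y; have := rhoK x.
  move: (rho' x) => x' /= x'E; set d := word_eval g w in IHw *.
  apply: (@brace_mulrI _ (phi (brace_lambda (g x') (g y)))).
  rewrite -phiM -{1}x'E -structure_brace_rho -brace_lambda_cocycle.
  rewrite brace_mulVKr IHw structure_brace_lambda phi_g -h_lam -x'E -h_rho.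
  by rewrite -brace_lambda_cocycle phiM phiV phi_g brace_mulVKr.
- rewrite brace_lambda_cocycle structure_brace_rho structure_brace_lambda.
  by rewrite !phiM IHw !phi_g -h_lam -h_rho -brace_lambda_cocycle.
Qed.

Lemma structure_lift_lambda a c :
  phi (brace_lambda a c) = brace_lambda (phi a) (phi c).
Proof.
case: gP => [[g_surj _] _]; have [w <-] := g_surj a.
elim: w c => [|[y []] w IHw] c /=; first by rewrite phi1 !brace_lambda1.
(* Applying the action of [h y] to both sides cancels the inverse letter and leaves the induction
   hypothesis. *)
- apply: (bij_inj (brace_lambda_bij (h y))).
  rewrite -structure_lift_lambda_gen -!brace_lambdaM brace_mulVKr IHw.
  by rewrite phiM phiV phi_g brace_mulVKr.
- by rewrite brace_lambdaM structure_lift_lambda_gen IHw -brace_lambdaM phiM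
    phi_g.
Qed.

(** Every [b] is [brace_lambda a c] for some [c], so that [a + b = a * c]: sums become products. *)
Lemma structure_lift_morphism : skew_brace_morphism phi.
Proof.
split=> // a b; have [lam' _ lamK] := brace_lambda_bij a.
by rewrite -(lamK b) brace_add_lambda structure_lift_lambda brace_add_lambda.
Qed.

End Extension.

End StructureSkewBrace.

Theorem theoremA (X : Type) (hX : inhabited X)
    (F : solution) (i : X -> F) (hF : is_free_solution X F i)
    (G : skewBraceType) (g : F -> G) (hG : is_structure_skew_brace F G g) :
  is_free_skew_brace X G (fun x : X => g (i x)).
Proof.
move=> K f; have [h [hP hi h_uniq]] := hF (brace_solution K) f.
have [phi [phi_g phiM]] := structure_lift_mul hG hP.
have phiP := structure_lift_morphism hG hP phi_g phiM.
exists phi; split=> // [x | psi psiP psi_f b]; first by rewrite phi_g hi.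
(* Both sides are the unique morphism of solutions [h] extending [f]. *)
have psi_g : psi \o g =1 phi \o g.
  move=> y /=; rewrite phi_g; apply: (h_uniq (psi \o g)) => // p.
  have := skew_brace_morphism_solution psiP (g p.1, g p.2).
  by rewrite (structure_solution_morphism hG p).
(* The image of [g] generates [G] multiplicatively, so agreement there suffices. *)
have [[g_surj _] _] := hG; have [w <-] := g_surj b.
by rewrite !skew_brace_morphism_word_eval //; apply: eq_word_eval.
Qed.
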